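(* For every $k\in\mathbb N$ and $\varepsilon>0$ there is $K=K(k,\varepsilon)$ such that the following holds. Let $\Gamma=(\Omega,\mathcal X)$ be a hypergraph and $\mathbf p\in(0,1)^\Omega$. If $\rho_{k+1}\le1-\varepsilon$, then \[\big|\log\Pr[X=0]+\kappa_1-\kappa_2+\kappa_3-\dots+(-1)^{k+1}\kappa_k\big|\le K\cdot(\delta_{1,K}+\Delta_{k+1,K}),\] where $\delta_{1,K}=\sum_{i=1}^K\delta_i$ and $\Delta_{k+1,K}=\sum_{i=k+1}^K\Delta_i$.
   Context: $\Gamma=(\Omega,\mathcal X)$ has finite vertex set $\Omega$ and edge set $\mathcal X$ (a set of subsets of $\Omega$); $\mathbf p=(p_\omega)_{\omega\in\Omega}$, and $\Omega_{\mathbf p}$ is the random subset of $\Omega$ containing each $\omega$ independently with probability $p_\omega$. Order the edges as $\gamma_1,\dots,\gamma_N$, let $X_i$ be the indicator of $\gamma_i\subseteq\Omega_{\mathbf p}$, $X=\sum_iX_i$, and $X_V=\prod_{i\in V}X_i$. The dependency graph $G_\Gamma$ on $[N]$ joins $i\ne j$ iff $\gamma_i\cap\gamma_j\ne\emptyset$; $\partial(V)$ is the set of vertices outside $V$ adjacent to some vertex of $V$. $\mathcal C_k$ is the family of $k$-element $V\subseteq[N]$ with $G_\Gamma[V]$ connected. For nonempty $V$, $\kappa(V)=\sum_{\pi}(-1)^{|\pi|-1}(|\pi|-1)!\prod_{P\in\pi}\mathbb E[X_P]$ over partitions $\pi$ of $V$ into nonempty parts. $\kappa_k=\sum_{V\in\mathcal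 C_k}\kappa(V)$, $\Delta_k=\sum_{V\in\mathcal C_k}\mathbb E[X_V]$, $\delta_k=\sum_{V\in\mathcal C_k}\mathbb E[X_V]\max_{i\in V}\mathbb E[X_i]$. Finally $\rho_k=\max\{\Pr[X_i=1\text{ for some }i\in V\cup\partial(V)]:V\subseteq[N],\,1\le|V|\le k\}$. *)

(* Defs.v *)
From mathcomp Require Import all_boot all_order all_algebra.
From mathcomp Require Import reals exp.

Set Implicit Arguments.
Unset Strict Implicit.
Unset Printing Implicit Defensive.

Import Order.TTheory GRing.Theory Num.Theory.

Local Open Scope ring_scope.

(* Random subset of [Omega] containing each [w] independently with            *)
(* probability [p w]: [rs_mass p S] is the probability that it equals [S].    *)
Section RandomSubset.
Variables (R : realType) (Omega : finType) (p : Omega -> R).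

Definition rs_mass (S : {set Omega}) : R :=
  \prod_(w : Omega) (if w \in S then p w else 1 - p w).

Definition rs_Pr (A : pred {set Omega}) : R := \sum_(S | A S) rs_mass S.

Definition rs_E (f : {set Omega} -> R) : R := \sum_S rs_mass S * f S.

End RandomSubset.

(* The hypergraph is given by its edge set [E]; its edges are indexed by      *)
(* ['I_#|E|] through the enumeration [enum_val].                              *)
Section Hypergraph.
Variables (Omega : finType) (E : {set {set Omega}}).

Definition edge (i : 'I_#|E|) : {set Omega} := enum_val i.

Definition dep_graph : rel 'I_#|E| :=
  fun i j => (i != j) && (edge i :&: edge j != set0).

Definition boundary (V : {set 'I_#|E|}) : {set 'I_#|E|} :=
  [set j | (j \notin V) && [exists i in V, dep_graph i j]].

Definition induced (V : {set 'I_#|E|}) : rel 'I_#|E| :=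
  fun i j => [&& i \in V, j \in V & dep_graph i j].

Definition connected_in (V : {set 'I_#|E|}) : bool :=
  (V != set0) && [forall i in V, forall j in V, connect (induced V) i j].

Definition clusters (k : nat) : {set {set 'I_#|E|}} :=
  [set V : {set 'I_#|E|} | (#|V| == k) && connected_in V].

End Hypergraph.

Section Quantities.
Variables (R : realType) (Omega : finType) (E : {set {set Omega}}).
Variable p : Omega -> R.

Definition Xind (i : 'I_#|E|) (S : {set Omega}) : R := (edge i \subset S)%:R.

Definition Xcount (S : {set Omega}) : R := \sum_(i < #|E|) Xind i S.

Definition Xprod (V : {set 'I_#|E|}) (S : {set Omega}) : R :=
  \prod_(i in V) Xind i S.

Definition joint_cumulant (V : {set 'I_#|E|}) : R :=
  \sum_(P : {set {set 'I_#|E|}} | partition P V)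
    (-1) ^+ (#|P| - 1) * ((#|P| - 1)`!)%:R * \prod_(Q in P) rs_E p (Xprod Q).

Definition kappa (k : nat) : R := \sum_(V in clusters E k) joint_cumulant V.

Definition Delta (k : nat) : R := \sum_(V in clusters E k) rs_E p (Xprod V).

(* All values in the two maxima below are nonnegative, so the default value 0 *)
(* matters only for an empty index set.                                       *)
Definition delta (k : nat) : R :=
  \sum_(V in clusters E k)
    rs_E p (Xprod V) * \big[Num.max/0]_(i in V) rs_E p (Xind i).

Definition rho (k : nat) : R :=
  \big[Num.max/0]_(V : {set 'I_#|E|} | (1 <= #|V| <= k)%N)
    rs_Pr p (fun S => [exists i in V :|: boundary V, Xind i S == 1]).

End Quantities.

(* Main.v *)
Require Import Defs.
From mathcomp Require Import all_boot all_order all_algebra.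
From mathcomp Require Import reals exp.
From mathcomp Require Import ring lra.

Set Implicit Arguments.
Unset Strict Implicit.
Unset Printing Implicit Defensive.

Import Order.TTheory GRing.Theory Num.Theory.

Local Open Scope ring_scope.

(* Let [e V] be the expectation of [X_V], and let [q(V; A)] be the expectation
   of [X_V] conditioned on [X_j = 0] for all [j] in [A].  By Harris' inequality
   [0 <= q(V; A) <= e V], and adding an index [b] to [A] gives
     [q(V; A + b) = q(V; A) - q(V + b; A) + q(V; A + b) * q(b; A)].
   The coefficients [c V T] of the formal quotient of the set series [e (V + -)]
   by [e] satisfy the same recursion up to overlapping pairs of index sets,
     [c V (T + b) = c (V + b) T - \sum_(W <= T) c V W * c b (T - W)],
   and [c {i} T] is the joint cumulant of [T + i].  Choosing [b] adjacent to [V],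
   an induction on the order [t] and on [A] shows that [q(V; A)] equals
   [\sum_(T <= A, |T| < t) (-1)^|T| * c V T] up to terms [e (V + T)] with [T]
   linked to [V] and either [t <= |T|] or an extra factor [e {j}], [j] in [V + T],
   the latter coming from overlaps.  Since [ln Pr(X = 0)] is the sum over [i] of
   [ln (1 - q(i; {j < i}))], and [ln (1 - q) = - q + O(q^2)], these expansions
   add up to the alternating sum of cumulants. *)

(** * Set convolution *)

Section SubsetSums.
Variables (R : comNzRingType) (I : finType).
Implicit Types (f g h : {set I} -> R) (T U V W : {set I}).

Lemma subsetU1_sum (b : I) T f : b \notin T ->
  \sum_(W : {set I} | W \subset b |: T) f W =
    \sum_(W : {set I} | W \subset T) f W
    + \sum_(W : {set I} | W \subset T) f (b |: W).
Proof.
move=> bT; rewrite (bigID (fun W : {set I} => b \in W)) /= addrC; congr (_ + _).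
  apply: eq_bigl => W; apply/andP/idP => [[sW bW]|sW].
    apply/subsetP => x xW; move: (subsetP sW x xW); rewrite !inE => /orP[/eqP xb|//].
    by rewrite -xb xW in bW.
  split; first exact: subset_trans sW (subsetUr _ _).
  by apply: contra bT => /(subsetP sW).
rewrite (reindex_onto (fun W => b |: W) (fun W => W :\ b)) /=; last first.
  by move=> W /andP[_ bW]; rewrite setD1K.
apply: eq_bigl => W; rewrite setU11 andbT; apply/andP/idP => [[sW /eqP eW]|sW].
  rewrite -eW; apply/subsetP => x; rewrite !inE => /andP[xb xW].
  move: (subsetP sW x); rewrite !inE (negbTE xb) /=; apply.
  by case/orP: xW => [xb'|//]; rewrite xb' in xb.
split; first exact: setUS.
by rewrite setU1K //; apply: contra bT => /(subsetP sW).
Qed.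

(** The product of set series, that is, of polynomials in commuting variables [x_i] with
    [x_i ^ 2 = 0]. *)
Definition conv f g T : R := \sum_(W : {set I} | W \subset T) f W * g (T :\: W).

Lemma eq_conv f f' g g' T :
  (forall U, U \subset T -> f U = f' U) -> (forall U, U \subset T -> g U = g' U) ->
  conv f g T = conv f' g' T.
Proof.
move=> ef eg; apply: eq_bigr => W sW; rewrite ef // eg //; exact: subsetDl.
Qed.

Lemma eq_convl f f' g T :
  (forall U, U \subset T -> f U = f' U) -> conv f g T = conv f' g T.
Proof. by move=> ef; apply: eq_conv. Qed.

Lemma eq_convr f g g' T :
  (forall U, U \subset T -> g U = g' U) -> conv f g T = conv f g' T.
Proof. by move=> eg; apply: eq_conv. Qed.

Lemma setDK T W : W \subset T -> T :\: (T :\: W) = W.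
Proof. by move=> sW; rewrite setDDr setDv set0U; apply/setIidPr. Qed.

Lemma setUDK U W : U \subset W -> U :|: (W :\: U) = W.
Proof.
by move=> /subsetP sUW; apply/setP => x; rewrite !inE; case: (boolP (x \in U)) => //= /sUW ->.
Qed.

Lemma convC f g T : conv f g T = conv g f T.
Proof.
rewrite /conv (reindex_onto (fun W => T :\: W) (fun W => T :\: W)) /=.
  apply: eq_big => [W|W /andP[_ /eqP eW]]; last by rewrite eW mulrC.
  rewrite subsetDl /=; apply/eqP/idP => [<-|/setDK //]; exact: subsetDl.
by move=> W /setDK.
Qed.

Lemma convA f g h T : conv (conv f g) h T = conv f (conv g h) T.
Proof.
rewrite /conv; under eq_bigr do rewrite big_distrl /=.
rewrite (exchange_big_dep (fun U : {set I} => U \subset T)) /=; last first.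
  by move=> W U sW sU; apply: subset_trans sW.
apply: eq_bigr => U sU; rewrite big_distrr /=.
rewrite (reindex_onto (fun X => U :|: X) (fun W => W :\: U)) /=; last first.
  by move=> W /andP[_ sUW]; rewrite setUDK.
apply: eq_big => [X|X].
  rewrite subUset sU subsetUl andbT /= setDUl setDv set0U subsetD.
  by congr (_ && _); apply/eqP/setDidPl.
move=> /andP[_ /eqP ->].
by rewrite -mulrA -setDDl.
Qed.

Definition unit_conv T : R := (T == set0)%:R.

Lemma conv1 f T : conv f unit_conv T = f T.
Proof.
rewrite /conv (bigD1 T) //= setDv /unit_conv eqxx mulr1 big1 ?addr0 // => W.
case/andP => sW nW; rewrite setD_eq0; case: (boolP (T \subset W)) => sT; rewrite ?mulr0 //.
by move: nW; rewrite eqEsubset sW sT.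
Qed.

(** Leibniz rule: [b] falls into exactly one of the two factors, so that shifting by [b] is a
    derivation. *)
Lemma convU1 b f g T : b \notin T ->
  conv f g (b |: T) =
    conv (fun U => f (b |: U)) g T + conv f (fun U => g (b |: U)) T.
Proof.
move=> bT; rewrite /conv subsetU1_sum // addrC; congr (_ + _); apply: eq_bigr => W sW.
  congr (_ * g _); apply/setP => x; rewrite !inE; case: eqP => // ->.
  by rewrite (negbTE bT) andbF.
congr (_ * g _); apply/setP => x; rewrite !inE; case: eqP => // ->.
by rewrite andbT (contra (subsetP sW b)).
Qed.

Lemma conv0 f g : conv f g set0 = f set0 * g set0.
Proof.
by rewrite /conv (big_pred1 set0) ?setD0 // => W; rewrite subset0.
Qed.

Lemma convNr f g T : conv f (fun U => - g U) T = - conv f g T.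
Proof. by rewrite /conv -sumrN; apply: eq_bigr => W _; rewrite mulrN. Qed.

Lemma convNl f g T : conv (fun U => - f U) g T = - conv f g T.
Proof. by rewrite convC convNr convC. Qed.

End SubsetSums.

(** * Partitions with a distinguished block *)

Section PartitionSums.
Variables (R : comNzRingType) (I : finType).
Implicit Types (T U V W Q : {set I}) (P : {set {set I}}).

Lemma partition_setU1 Q P U :
  Q != set0 -> Q \subset U -> partition P (U :\: Q) -> Q \notin P /\ partition (Q |: P) U.
Proof.
move=> Q0 sQ /and3P[/eqP cP tP nP].
have QP : Q \notin P.
  apply/negP => QP; case/set0Pn: Q0 => x xQ.
  have : x \in U :\: Q by rewrite -cP; apply/bigcupP; exists Q.
  by rewrite inE xQ.
split=> //; apply/and3P; split.
- rewrite /cover big_setU1 //= -/(cover P) cP; apply/eqP.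
  by rewrite setUDK.
- have /trivIsetP tP' := tP; apply/trivIsetP => A B.
  have dQ C : C \in P -> [disjoint Q & C].
    move=> CP; rewrite -setI_eq0 -subset0; apply/subsetP => x; rewrite inE => /andP[xQ xC].
    have : x \in U :\: Q by rewrite -cP; apply/bigcupP; exists C.
    by rewrite inE xQ.
  rewrite !inE => /orP[/eqP->|AP] /orP[/eqP->|BP].
  + by rewrite eqxx.
  + by move=> _; apply: dQ.
  + by move=> _; rewrite disjoint_sym; apply: dQ.
  + exact: tP'.
- by rewrite !inE negb_or eq_sym Q0.
Qed.

Lemma partition_setD1 Q P U :
  partition P U -> Q \in P -> [/\ Q != set0, Q \subset U & partition (P :\ Q) (U :\: Q)].
Proof.
move=> /and3P[/eqP cP tP nP] QP.
have Q0 : Q != set0 by apply: contraNneq nP => <-.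
have sQ : Q \subset U by rewrite -cP; apply: bigcup_sup.
split=> //; apply/and3P; split; last first.
- by rewrite !inE negb_and nP orbT.
- by apply: trivIsetS tP; apply: subD1set.
have /trivIsetP tP' := tP.
have -> : U = Q :|: cover (P :\ Q) by rewrite -cP /cover (big_setD1 Q).
rewrite setDUl setDv set0U eq_sym; apply/eqP/setDidPl.
rewrite -setI_eq0 -subset0; apply/subsetP => x; rewrite inE => /andP[/bigcupP[C]].
rewrite !inE => /andP[CQ CP] xC xQ.
by have /disjointFr/(_ xC) := tP' C Q CP QP CQ; rewrite xQ.
Qed.

(** Double counting: the distinguished block is chosen first, and the other blocks then partition
    its complement. *)
Lemma partition_sum_pointed (pr : pred {set I}) U (F : {set I} -> {set {set I}} -> R) :
  \sum_(P : {set {set I}} | partition P U) \sum_(Q in P | pr Q) F Q (P :\ Q) =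
  \sum_(Q : {set I} | [&& Q != set0, Q \subset U & pr Q])
     \sum_(P : {set {set I}} | partition P (U :\: Q)) F Q P.
Proof.
rewrite (exchange_big_dep (fun Q : {set I} => [&& Q != set0, Q \subset U & pr Q])) /=; last first.
  by move=> P Q pP /andP[QP ->]; have [-> -> _] := partition_setD1 pP QP.
apply: eq_bigr => Q /and3P[Q0 sQ prQ].
rewrite (reindex_onto (fun P => Q |: P) (fun P => P :\ Q)) /=; last first.
  by move=> P /and3P[_ QP _]; rewrite setD1K.
rewrite prQ; apply: eq_big => [P|P /andP[_ /eqP -> //]].
rewrite setU11 !andbT; apply/andP/idP => [[pP /eqP eP]|pP].
  have [_ _] := partition_setD1 pP (setU11 _ _); by rewrite eP.
have [QP pQP] := partition_setU1 Q0 sQ pP.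
by rewrite pQP setU1K.
Qed.

End PartitionSums.

(** * Inverse, cumulants and quotients of set series *)

Section ConvolutionInverse.
Variables (R : comNzRingType) (I : finType) (e : {set I} -> R).
Hypothesis e0 : e set0 = 1.
Implicit Types (T U V W Q : {set I}) (P : {set {set I}}).

(** The geometric series for [1 / e]: the factorial counts the orderings of the blocks. *)
Definition cinv U : R :=
  \sum_(P : {set {set I}} | partition P U) (-1) ^+ #|P| * (#|P|)`!%:R * \prod_(Q in P) e Q.

(** For nonempty [U], the coefficient of the logarithm of the set series [e]; for [e := moment p] it
    is [joint_cumulant]. *)
Definition cumulant U : R :=
  \sum_(P : {set {set I}} | partition P U)
    (-1) ^+ (#|P| - 1) * ((#|P| - 1)`!)%:R * \prod_(Q in P) e Q.

(* The coefficient at [T] of the quotient of the set series [e (V :|: -)] by [e]. *)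
Definition cluster_coef V T : R := conv (fun W => e (V :|: W)) cinv T.

Lemma cinv0 : cinv set0 = 1.
Proof.
rewrite /cinv (big_pred1 set0) => [|P]; last by rewrite partition_set0.
by rewrite cards0 big_set0 expr0 fact0 !mulr1.
Qed.

(** Distinguishing one block of each partition gives the recursion that an inverse of [e] must
    satisfy. *)
Lemma cinvE U : U != set0 ->
  cinv U = - \sum_(Q : {set I} | (Q != set0) && (Q \subset U)) e Q * cinv (U :\: Q).
Proof.
move=> U0.
have := partition_sum_pointed predT U
  (fun Q P => - (e Q * ((-1) ^+ #|P| * (#|P|)`!%:R * \prod_(Q in P) e Q))).
under [X in _ = X -> _]eq_bigl do rewrite andbT.
rewrite -sumrN /cinv => /esym H.
under [RHS]eq_bigr => Q _ do rewrite big_distrr -sumrN /=.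
rewrite H; apply: eq_bigr => P pP.
under [RHS]eq_bigl do rewrite andbT.
have P0 : (0 < #|P|)%N.
  rewrite card_gt0; apply: contraNneq U0 => P0; move: pP; rewrite P0 => /and3P[/eqP <- _ _].
  by rewrite /cover big_set0.
(* All [#|P|] blocks contribute equally, which turns the factorial of [#|P| - 1] into that of
   [#|P|]. *)
rewrite [RHS](eq_bigr (fun=> (-1) ^+ #|P| * (#|P| - 1)`!%:R * \prod_(Q in P) e Q)).
  rewrite sumr_const -[RHS]mulr_natr [RHS]mulrAC; congr (_ * _).
  rewrite -[RHS]mulrA -natrM; congr (_ * _%:R).
  by case: #|P| P0 => // n _; rewrite factS subn1 /= mulnC.
move=> Q QP; rewrite (cardsD1 Q P) QP add1n subn1 /= exprS [in RHS](big_setD1 Q) //=.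
by rewrite !mulN1r !mulNr; congr (- _); rewrite mulrCA.
Qed.

Lemma conv_cinv U : conv e cinv U = unit_conv R U.
Proof.
rewrite /unit_conv; have [->|U0] := eqVneq U set0; first by rewrite conv0 cinv0 e0 mulr1.
rewrite /conv (bigD1 set0) ?sub0set //= e0 mul1r setD0 cinvE // addrC.
by apply/eqP; rewrite subr_eq0; apply/eqP; apply: eq_bigl => Q; rewrite andbC.
Qed.

(** Each partition of [i |: T] has exactly one block containing [i]; the other [#|P| - 1] blocks
    carry the weight that they have in [cinv]. *)
Lemma cumulantU1 i T : i \notin T -> cumulant (i |: T) = cluster_coef [set i] T.
Proof.
move=> iT; rewrite /cluster_coef /conv /cumulant.
have := partition_sum_pointed (fun Q => i \in Q) (i |: T)
  (fun Q P => e Q * ((-1) ^+ #|P| * (#|P|)`!%:R * \prod_(Q in P) e Q)).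
rewrite (eq_bigr (fun P : {set {set I}} =>
  (-1) ^+ (#|P| - 1) * ((#|P| - 1)`!)%:R * \prod_(Q in P) e Q)).
  move=> ->; rewrite (reindex_onto (fun W => i |: W) (fun W => W :\ i)) /=; last first.
    by move=> W /and3P[_ _ iW]; rewrite setD1K.
  apply: eq_big => [W|W].
    rewrite setU11 andbT -card_gt0 cardsU1 addn_gt0 orbC.
    apply/andP/idP => [[/andP[_ sW] /eqP eW]|sW].
      have iW : i \notin W by rewrite -eW !inE eqxx.
      apply/subsetP => x xW; move: (subsetP sW x).
      by rewrite !inE xW orbT => /(_ isT) /orP[/eqP xi|//]; rewrite -xi xW in iW.
    have iW : i \notin W by apply: contra iT => /(subsetP sW).
    by rewrite iW orbT setUS // setU1K.
  move=> /andP[_ /eqP eW]; have iW : i \notin W by rewrite -eW !inE eqxx.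
  rewrite -big_distrr /=; congr (_ * cinv _).
  by apply/setP => x; rewrite !inE; case: eqP => //= ->; rewrite (negbTE iT) andbF.
move=> P pP; have [cP tP _] := and3P pP.
have iP : i \in cover P by rewrite (eqP cP) setU11.
rewrite (big_pred1 (pblock P i)).
  rewrite [in RHS](big_setD1 (pblock P i)) ?pblock_mem //= [in RHS](cardsD1 (pblock P i) P).
  by rewrite pblock_mem // add1n subn1 /= mulrCA.
move=> Q /=; apply/andP/eqP => [[QP iQ]|->]; first by rewrite (def_pblock tP QP).
by rewrite pblock_mem // mem_pblock.
Qed.

Lemma cluster_coef0 V : cluster_coef V set0 = e V.
Proof. by rewrite /cluster_coef conv0 setU0 cinv0 mulr1. Qed.

(** The derivative of [1 / e]: apply the Leibniz rule to [conv e cinv], which is the unit, and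
    multiply by [cinv]. *)
Lemma cinvU1 b T : b \notin T -> cinv (b |: T) = - conv (cluster_coef [set b]) cinv T.
Proof.
move=> bT.
have dE U : U \subset T ->
    conv (fun W => cinv (b |: W)) e U = - conv (fun W => e (b |: W)) cinv U.
  move=> sU; have bU : b \notin U by apply: contra bT => /(subsetP sU).
  have := conv_cinv (b |: U); rewrite /unit_conv setU_eq0 -cards_eq0 cards1 /= convU1 // addrC.
  by rewrite [conv e _ _]convC => /eqP; rewrite addr_eq0 => /eqP.
rewrite -[LHS](conv1 (fun W => cinv (b |: W))).
rewrite -(eq_convr _ (g := conv e cinv)) => [|U _]; last exact: conv_cinv.
rewrite -convA (eq_convl _ dE).
by rewrite convNl.
Qed.

(** The quotient rule. *)
Lemma cluster_coefU1 b V T : b \notin T ->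
  cluster_coef V (b |: T) =
    cluster_coef (b |: V) T - conv (cluster_coef V) (cluster_coef [set b]) T.
Proof.
move=> bT; rewrite {1}/cluster_coef convU1 //; congr (_ + _).
  by apply: eq_conv => // U _; rewrite setUCA setUA.
rewrite convA -convNr; apply: eq_conv => // U sU.
rewrite cinvU1 ?(contra (subsetP sU b)) //; congr (- _); exact: convC.
Qed.

(** The factor [e V] comes out and leaves the convolution of [e] with its inverse, which vanishes at
    nonempty sets. *)
Lemma cluster_coef_separated V T :
  (forall W, W \subset T -> e (V :|: W) = e V * e W) -> T != set0 -> cluster_coef V T = 0.
Proof.
move=> eVW T0; rewrite /cluster_coef /conv.
under eq_bigr => W sW do rewrite eVW // -mulrA.
by rewrite -big_distrr /= [X in _ * X](conv_cinv T) /unit_conv (negbTE T0) mulr0.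
Qed.

End ConvolutionInverse.

(** * Expansion of the conditional expectations *)

Section Rooted.
Variables (I : finType) (adj : rel I).
Implicit Types (T U V W : {set I}).

Definition touch V W := [exists i in V, exists j in W, adj i j].

Lemma touchP V W : reflect (exists i j, [/\ i \in V, j \in W & adj i j]) (touch V W).
Proof.
apply: (iffP exists_inP) => [[i iV /exists_inP[j jW ij]]|[i [j [iV jW ij]]]].
  by exists i, j.
by exists i => //; apply/exists_inP; exists j.
Qed.

Lemma touchS V V' W W' : V \subset V' -> W \subset W' -> touch V W -> touch V' W'.
Proof.
move=> /subsetP sV /subsetP sW /touchP[i [j [iV jW ij]]]; apply/touchP; exists i, j.
by rewrite sV // sW.
Qed.

(* Every vertex of [T] is linked to [V] inside [V :|: T], expressed through cuts. *)
Definition rooted V T :=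
  [forall U : {set I}, (U \subset T) && (U != set0) ==> touch ((V :|: T) :\: U) U].

Lemma rootedP V T :
  reflect (forall U, U \subset T -> U != set0 -> touch ((V :|: T) :\: U) U) (rooted V T).
Proof.
apply: (iffP forallP) => [H U sU U0|H U]; first by have := H U; rewrite sU U0.
by apply/implyP => /andP[]; apply: H.
Qed.

Lemma rooted0 V : rooted V set0.
Proof. by apply/rootedP => U; rewrite subset0 => ->. Qed.

Section Attach.
Variables (b : I) (V : {set I}).
Hypothesis bV : touch V [set b].

(** A cut containing [b] is crossed by the edge from [V] to [b]; for any other cut, [b] may be
    counted among the roots. *)
Lemma rooted_setU1 T :
  [disjoint V & b |: T] -> rooted (b |: V) T -> rooted V (b |: T).
Proof.
move=> dT /rootedP rT; apply/rootedP => U sU U0.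
have dU x : x \in V -> x \notin U.
  by move=> xV; apply: contraFN (disjointFr dT xV) => /(subsetP sU).
have [bU|bU] := boolP (b \in U).
  have /touchP[i [j [iV /set1P -> ij]]] := bV.
  by apply/touchP; exists i, b; rewrite !inE iV bU dU.
have sUT : U \subset T.
  apply/subsetP => x xU; move: (subsetP sU x xU); rewrite !inE => /orP[/eqP xb|//].
  by rewrite -xb xU in bU.
by apply: touchS (rT U sUT U0) => //; rewrite setUCA setUA.
Qed.

(** A cut avoiding [b] meets [W] or [W'], and an edge crossing its trace on that set crosses the cut
    itself. *)
Lemma rooted_merge W W' :
  [disjoint V & b |: (W :|: W')] -> rooted V W -> rooted [set b] W' ->
  rooted V (b |: (W :|: W')).
Proof.
move=> dT /rootedP rW /rootedP rW'; apply/rootedP => U sU U0.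
have dU x : x \in V -> x \notin U.
  by move=> xV; apply: contraFN (disjointFr dT xV) => /(subsetP sU).
have [bU|bU] := boolP (b \in U).
  have /touchP[i [j [iV /set1P -> ij]]] := bV.
  by apply/touchP; exists i, b; rewrite !inE iV bU dU.
have [x xU] := set0Pn _ U0.
have := subsetP sU x xU; rewrite !inE => /or3P[/eqP xb|xW|xW'].
- by rewrite -xb xU in bU.
- have n0 : U :&: W != set0 by apply/set0Pn; exists x; rewrite inE xU.
  have /touchP[i [j [iX]]] := rW _ (subsetIr _ _) n0.
  rewrite inE => /andP[jU jW] ij; apply/touchP; exists i, j; split=> //.
  move: iX; rewrite !inE; have [iV|_] /= := boolP (i \in V); first by rewrite dU.
  by case: (i \in W); case: (i \in U) => //=; rewrite ?andbF ?orbT.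
- have n0 : U :&: W' != set0 by apply/set0Pn; exists x; rewrite inE xU.
  have /touchP[i [j [iX]]] := rW' _ (subsetIr _ _) n0.
  rewrite inE => /andP[jU jW] ij; apply/touchP; exists i, j; split=> //.
  move: iX; rewrite !inE; have [->|_] /= := eqVneq i b; first by rewrite (negbTE bU) orbT.
  by case: (i \in W'); case: (i \in U) => //=; rewrite ?andbF ?orbT.
Qed.

End Attach.
End Rooted.

(** One use of [cluster_coefU1] produces one coefficient and at most [2 ^ t'] products of two
    coefficients. *)
Fixpoint coef_bound (t : nat) : nat :=
  if t is t'.+1 then (coef_bound t' + 2 ^ t' * coef_bound t' ^ 2)%N else 1%N.

Lemma coef_bound_gt0 t : (0 < coef_bound t)%N.
Proof. by elim: t => //= t IH; rewrite addn_gt0 IH. Qed.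

(** Both [W] and [W'] are subsets of the union [T], so a set [T] of at most [l] elements arises from
    at most [4 ^ l] pairs. *)
Lemma sum_union_pairs (R : realFieldType) (I : finType) (h : {set I} -> R) (l : nat)
    (b : I) (B : {set I}) :
  (forall T, 0 <= h T) -> (forall T : {set I}, (l < #|T|)%N -> h T = 0) -> b \notin B ->
  \sum_(W : {set I} | W \subset b |: B) \sum_(W' : {set I} | W' \subset B) h (b |: (W :|: W'))
    <= (4 ^ l)%:R * \sum_(T : {set I} | T \subset B) h (b |: T).
Proof.
move=> h_ge0 h_eq0 bB; rewrite pair_big /=.
rewrite (partition_big (fun x => b |: (x.1 :|: x.2))
  (fun T : {set I} => (T \subset b |: B) && (b \in T))) /=; last first.
  move=> [W W'] /= /andP[sW sW']; rewrite setU11 andbT !subUset sub1set setU11 sW /=.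
  exact: subset_trans sW' (subsetUr _ _).
apply: (@le_trans _ _ (\sum_(T : {set I} | (T \subset b |: B) && (b \in T)) (4 ^ l)%:R * h T)).
  apply: ler_sum => T /andP[sT bT].
  have [lT|lT] := ltnP l #|T|.
    by rewrite big1 ?h_eq0 ?mulr0 // => x /andP[_ /eqP ->]; rewrite h_eq0.
  rewrite (eq_bigr (fun=> h T)) => [|x /andP[_ /eqP -> //]].
  rewrite sumr_const -[leLHS]mulr_natl ler_wpM2r // ler_nat.
  apply: (@leq_trans #|setX (powerset T) (powerset T)|).
    apply/subset_leq_card/subsetP => -[W W']; rewrite !inE /= => /andP[_ /eqP <-].
    by rewrite -subUset subsetUr.
  rewrite cardsX card_powerset -expnMn leq_exp2l //.
rewrite -big_distrr /= ler_wpM2l // big_mkcondr subsetU1_sum //= big1 ?add0r.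
  by apply: ler_sum => T _; rewrite setU11.
by move=> T sT; rewrite (negbTE (contra (subsetP sT b) bB)).
Qed.

(** If [W] and [W'] have at most [r] elements, then [b |: (W :|: W')] has at most [2 * r + 1]. *)
Fixpoint range_bound (t : nat) : nat :=
  if t is t'.+1 then (2 * range_bound t').+1 else 0%N.

(** The first [M] pays for the expansion with [b] joined to [V], the bracket for
    [product_expansion], and the power of 4 for [sum_union_pairs]. *)
Fixpoint error_bound (t : nat) : nat :=
  if t is t'.+1 then
    let C := coef_bound t' in let M := error_bound t' in
    (M + (2 * M + 2 * (C * M) + C ^ 2) * 4 ^ range_bound t'.+1)%N
  else 1%N.

Lemma leq_range_bound t : (t <= range_bound t)%N.
Proof. by elim: t => //= t IH; rewrite ltnS mul2n -addnn (leq_trans IH) ?leq_addr. Qed.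

(** * Expansion of [q(V; A)] for an abstract set function *)

Section ConditionalExpansion.
Variables (R : realFieldType) (I : finType) (adj : rel I) (e : {set I} -> R).
Implicit Types (A B T U V W : {set I}).

Hypothesis e0 : e set0 = 1.
Hypothesis e_ge0 : forall V, 0 <= e V.
Hypothesis e_anti : forall V W, V \subset W -> e W <= e V.
(** When [V] and [W] meet, the factor [e (V :&: W)] is the source of the extra factor [e {j}] in the
    error terms. *)
Hypothesis e_cap : forall V W, e V * e W <= e (V :|: W) * e (V :&: W).
Hypothesis e_sep : forall V W, [disjoint V & W] -> ~~ touch adj V W -> e (V :|: W) = e V * e W.

Local Notation rooted := (rooted adj).
Local Notation touch := (touch adj).
Local Notation coef := (cluster_coef e).

Lemma e_le1 V : e V <= 1.
Proof. by rewrite -e0 e_anti // sub0set. Qed.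

Lemma e_mul_le V W : e V * e W <= e (V :|: W).
Proof. by apply: le_trans (e_cap V W) _; rewrite ler_piMr ?e_le1. Qed.

Lemma cluster_coef_untouched V T :
  [disjoint V & T] -> ~~ touch V T -> T != set0 -> coef V T = 0.
Proof.
move=> dVT nt; apply: cluster_coef_separated => // W sW.
apply: e_sep; first by apply: disjointWr dVT.
by apply: contra nt; apply: touchS.
Qed.

Lemma touch_pick V T : touch V T -> exists2 b, b \in T & touch V [set b].
Proof.
move=> /touchP[i [j [iV jT ij]]]; exists j => //.
by apply/touchP; exists i, j; rewrite inE.
Qed.

(** Induction through [cluster_coefU1] with some [b] in [T] adjacent to [V]; if there is none, the
    coefficient vanishes unless [T] is empty. Linkage passes from the smaller sets to [T] by
    [rooted_setU1] and [rooted_merge]. *)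
Lemma cluster_coef_bound t V T : [disjoint V & T] -> (#|T| <= t)%N ->
  `|coef V T| <= (coef_bound t)%:R * (rooted V T)%:R * e (V :|: T).
Proof.
elim: t V T => [|t IH] V T dT cT.
  have -> : T = set0 by apply/eqP; rewrite -cards_eq0 -leqn0.
  by rewrite cluster_coef0 rooted0 /= setU0 !mul1r ger0_norm.
have [->|T0] := eqVneq T set0.
  rewrite cluster_coef0 rooted0 setU0 ger0_norm // mulr1 ler_peMl //.
  by rewrite ler1n coef_bound_gt0.
have [tT|nT] := boolP (touch V T); last first.
  by rewrite cluster_coef_untouched // normr0 mulr_ge0 // mulr_ge0.
have [b bT bV] := touch_pick tT.
have eT := setD1K bT; set T' := T :\ b in eT.
have bT' : b \notin T' by rewrite !inE eqxx.
have cT' : (#|T'| <= t)%N by move: cT; rewrite (cardsD1 b) bT.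
have nbV : b \notin V by apply/negP => /(disjointFr dT); rewrite bT.
have dT' : [disjoint V & T'] by apply: disjointWr dT; apply: subD1set.
have dbT' : [disjoint b |: V & T'].
  rewrite -setI_eq0 -subset0; apply/subsetP => x; rewrite in_setI in_setU1.
  move=> /andP[/orP[/eqP->|xV] xT']; first by rewrite xT' in bT'.
  by rewrite (disjointFr dT' xV) in xT'.
rewrite -eT cluster_coefU1 //; apply: (le_trans (ler_normB _ _)).
rewrite /= natrD !mulrDl lerD //.
  apply: le_trans (IH _ _ dbT' cT') _; rewrite setUCA setUA ler_wpM2r // ler_wpM2l //.
  rewrite ler_nat; have [r|//] := boolP (rooted (b |: V) T').
  by rewrite rooted_setU1 // eT.
apply: (le_trans (ler_norm_sum _ _ _)).
apply: (@le_trans _ _ (\sum_(W : {set I} | W \subset T')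
   (coef_bound t ^ 2)%:R * (rooted V (b |: T'))%:R * e (V :|: (b |: T')))).
  apply: ler_sum => W sW; rewrite normrM.
  have sW' : T' :\: W \subset T' by apply: subsetDl.
  have dW : [disjoint V & W] by apply: disjointWr dT'.
  have dbW : [disjoint [set b] & T' :\: W].
    rewrite disjoints1; by apply: contra bT' => /(subsetP sW').
  have H1 := IH _ _ dW (leq_trans (subset_leq_card sW) cT').
  have H2 := IH _ _ dbW (leq_trans (subset_leq_card sW') cT').
  apply: le_trans (ler_pM _ _ H1 H2) _ => //.
  rewrite expnS expn1 natrM mulrACA [X in X * _ <= _]mulrACA -!mulrA; do 2!rewrite ler_wpM2l //.
  have [r1|_] := boolP (rooted V W); last by rewrite !mul0r mulr_ge0.
  have [r2|_] := boolP (rooted [set b] _); last by rewrite mul0r mulr0 mulr_ge0.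
  have eW : W :|: (T' :\: W) = T' by rewrite setUDK.
  have := rooted_merge bV (W := W) (W' := T' :\: W); rewrite eW eT => -> //.
  have -> : V :|: T = V :|: W :|: (b |: (T' :\: W)) by rewrite -setUA [W :|: _]setUCA eW eT.
  by rewrite !mul1r e_mul_le.
rewrite sumr_const -[leLHS]mulr_natl 2!mulrA -natrM ler_wpM2r // ler_wpM2r // ler_nat leq_mul2r.
apply/orP; right; rewrite (eq_card (B := powerset T')) => [|W]; last by rewrite powersetE.
by rewrite card_powerset leq_exp2l.
Qed.

(* By inclusion-exclusion, the expectation of [X_V * \prod_(j in A) (1 - X_j)]. *)
Definition avoid V A : R := \sum_(T : {set I} | T \subset A) (-1) ^+ #|T| * e (V :|: T).

Hypothesis avoid_ge0 : forall V A, 0 <= avoid V A.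
Hypothesis avoid0_gt0 : forall A, 0 < avoid set0 A.
Hypothesis avoid_le : forall V A, avoid V A <= e V * avoid set0 A.

(** This is [q(V; A)]: the division conditions on the avoidance of [A]. *)
Definition cavoid V A : R := avoid V A / avoid set0 A.

Lemma avoidU1 b V A : b \notin A -> avoid V (b |: A) = avoid V A - avoid (b |: V) A.
Proof.
move=> bA; rewrite /avoid subsetU1_sum // -sumrN; congr (_ + _); apply: eq_bigr => W sW.
by rewrite cardsU1 (contra (subsetP sW b)) // add1n exprS mulN1r mulNr setUCA setUA.
Qed.

Lemma cavoid_ge0 V A : 0 <= cavoid V A.
Proof. by rewrite divr_ge0 // ltW. Qed.

Lemma cavoid_le V A : cavoid V A <= e V.
Proof. by rewrite ler_pdivrMr. Qed.

Lemma cavoid_untouched V A : [disjoint V & A] -> ~~ touch V A -> cavoid V A = e V.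
Proof.
move=> dA nA; rewrite /cavoid; suff -> : avoid V A = e V * avoid set0 A.
  by rewrite mulfK // gt_eqF.
rewrite /avoid big_distrr /=; apply: eq_bigr => T sT.
rewrite mulrCA set0U; congr (_ * _); apply: e_sep; first exact: disjointWr dA.
by apply: contra nA; apply: touchS.
Qed.

(** Conditioning also on [X_b = 0] divides by a further [1 - q(b; A)]. This denominator is cleared,
    which puts [q(V; A + b)] on both sides. *)
Lemma cavoidU1 b V A : b \notin A ->
  cavoid V (b |: A) = cavoid V A - cavoid (b |: V) A + cavoid V (b |: A) * cavoid [set b] A.
Proof.
move=> bA; have ZA := avoid0_gt0 A; have ZbA := avoid0_gt0 (b |: A).
have EV := avoidU1 V bA; have E0 := avoidU1 set0 bA; rewrite setU0 in E0.
rewrite /cavoid -mulrBl -EV.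
have -> : avoid [set b] A = avoid set0 A - avoid set0 (b |: A) by rewrite E0 opprB addrC subrK.
rewrite mulrBl divff ?gt_eqF // mulrBr mulr1 addrCA mulrA divfK ?gt_eqF //.
by rewrite subrr addr0.
Qed.

Definition emax V : R := \big[Num.max/0]_(i in V) e [set i].

Lemma emax_ge0 V : 0 <= emax V.
Proof. by rewrite /emax; elim/big_rec: _ => // i x _ x0; rewrite le_max x0 orbT. Qed.

Lemma le_emax i V : i \in V -> e [set i] <= emax V.
Proof. by move=> iV; rewrite /emax (bigD1 i) //= le_max lexx. Qed.

Lemma emaxS V W : V \subset W -> emax V <= emax W.
Proof.
move=> /subsetP sV; rewrite {1}/emax; elim/big_ind: _ => [|x y xW yW|i iV].
- exact: emax_ge0.
- by rewrite ge_max xW.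
- exact/le_emax/sV.
Qed.

Lemma e_le_emax i V W : i \in V -> i \in W -> e V <= emax W.
Proof. by move=> iV iW; apply: le_trans (le_emax iW); rewrite e_anti ?sub1set. Qed.

Definition rootind l V T : R := (rooted V T && (#|T| <= l)%N)%:R.

(** The two kinds of error, an extra factor [e {j}] and a size of at least [t], are added so that
    one expression covers both. *)
Definition weight t V T : R :=
  rootind (range_bound t) V T * (e (V :|: T) * (emax (V :|: T) + (t <= #|T|)%N%:R)).

Definition term t V T : R := (#|T| < t)%N%:R * ((-1) ^+ #|T| * coef V T).

Lemma rootind_ge0 l V T : 0 <= rootind l V T.
Proof. exact: ler0n. Qed.

Lemma weight_ge0 t V T : 0 <= weight t V T.
Proof. by rewrite mulr_ge0 ?rootind_ge0 // mulr_ge0 // addr_ge0 ?emax_ge0. Qed.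

Lemma term_bound t V T : [disjoint V & T] ->
  `|term t V T| <= (coef_bound t)%:R * (rootind (range_bound t) V T * e (V :|: T)).
Proof.
move=> dT; rewrite /term /rootind; case: ltnP => /= tT; last first.
  by rewrite mul0r normr0 mulr_ge0 // mulr_ge0.
rewrite mul1r normrM normrX normrN1 expr1n mul1r.
have lT := leq_trans (ltnW tT) (leq_range_bound t).
rewrite lT andbT mulrA; exact: (cluster_coef_bound dT (ltnW tT)).
Qed.

(** * One induction step: enlarging the avoided set by an index adjacent to [V] *)

Section Step.
Variables (t : nat) (b : I) (V B : {set I}).
Hypotheses (bB : b \notin B) (dV : [disjoint V & b |: B]) (bV : touch V [set b]).

Let l := range_bound t.

Lemma weight_setU1 T : T \subset B -> weight t (b |: V) T <= weight t.+1 V (b |: T).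
Proof.
move=> sT; have bT : b \notin T by apply: contra bB => /(subsetP sT).
rewrite /weight setUCA setUA cardsU1 bT add1n ltnS ler_wpM2r //.
  by rewrite mulr_ge0 // addr_ge0 ?emax_ge0.
rewrite /rootind ler_nat; case: (boolP (_ && _)) => // /andP[rT lT].
rewrite rooted_setU1 //=; last by apply: disjointWr dV; apply: setUS.
by rewrite cardsU1 bT add1n ltnS mul2n -addnn (leq_trans lT) ?leq_addr.
Qed.

(** The pairs absent from the truncated convolution, in which [W] avoids [b], is disjoint from [W'],
    and has fewer than [t] elements together with it. *)
Definition overlapping W W' := [|| b \in W, ~~ [disjoint W & W'] | (t <= #|W| + #|W'|)%N].

(** If [x] is not small itself, the overlap supplies the gain: an index common to [V :|: W] and
    [b |: W'] yields a factor [emax] by [e_cap], and otherwise the union has more than [t]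
    elements. *)
Lemma weight_merge W W' x : W \subset b |: B -> W' \subset B ->
  0 <= x -> x <= emax (V :|: (b |: (W :|: W'))) \/ x <= 1 /\ overlapping W W' ->
  rootind l V W * rootind l [set b] W' * (e (V :|: W) * e (b |: W')) * x
    <= weight t.+1 V (b |: (W :|: W')).
Proof.
move=> sW sW' x0 hx; rewrite /weight /rootind.
have [/andP[rW cW]|_] := boolP (rooted V W && _); last by rewrite !mul0r weight_ge0.
have [/andP[rW' cW']|_] := boolP (rooted [set b] W' && _); last first.
  by rewrite mulr0 !mul0r weight_ge0.
rewrite !mul1r.
have sT : b |: (W :|: W') \subset b |: B.
  by rewrite !subUset sub1set setU11 sW (subset_trans sW') ?subsetUr.
rewrite rooted_merge //=; last exact: disjointWr dV.
have -> : (#|b |: (W :|: W')| <= (2 * range_bound t).+1)%N.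
  rewrite cardsU1 -(add1n (2 * _)) leq_add ?leq_b1 // mul2n -addnn.
  by rewrite (leq_trans (leq_card_setU _ _)) // leq_add.
rewrite mul1r; set T := b |: (W :|: W').
have eT : (V :|: W) :|: (b |: W') = V :|: T by rewrite /T -setUA [W :|: _]setUCA.
have ee : e (V :|: W) * e (b |: W') <= e (V :|: T).
  by rewrite -eT e_mul_le.
have mT := emax_ge0 (V :|: T).
have ee_ge0 : 0 <= e (V :|: W) * e (b |: W') by rewrite mulr_ge0.
case: hx => [hx|[x1 ov]].
  by rewrite ler_pM // (le_trans hx) // lerDl.
have common i : i \in V :|: W -> i \in b |: W' ->
    e (V :|: W) * e (b |: W') <= e (V :|: T) * emax (V :|: T).
  move=> iW iW'; apply: le_trans (e_cap _ _) _; rewrite eT ler_wpM2l //.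
  by apply: (@e_le_emax i); rewrite -?eT inE iW ?iW'.
have done_common : e (V :|: W) * e (b |: W') <= e (V :|: T) * emax (V :|: T) ->
    e (V :|: W) * e (b |: W') * x <= e (V :|: T) * (emax (V :|: T) + (t < #|T|)%N%:R).
  move=> H; apply: (@le_trans _ _ (e (V :|: W) * e (b |: W'))); first by rewrite ler_piMr.
  by apply: le_trans H _; rewrite ler_wpM2l // lerDl.
(* Here [b] itself is a common index, since it belongs to [b |: W']. *)
have [bW|bW] := boolP (b \in W).
  by apply/done_common/(common b); rewrite !inE ?bW ?eqxx ?orbT.
have [dWW'|] := boolP [disjoint W & W']; last first.
  rewrite -setI_eq0 => /set0Pn[i]; rewrite inE => /andP[iW iW'].
  by apply/done_common/(common i); rewrite !inE ?iW ?iW' ?orbT.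
move: ov; rewrite /overlapping (negbTE bW) dWW' /= => tW.
have bW' : b \notin W' by apply: contra bB => /(subsetP sW').
(* The three parts of [T] are disjoint, and [b] adds one to a size of at least [t]. *)
have -> : (t < #|T|)%N.
  move: dWW'; rewrite -setI_eq0 => /eqP dWW'.
  by rewrite cardsU1 !inE negb_or bW bW' add1n ltnS cardsU dWW' cards0 subn0.
apply: (@le_trans _ _ (e (V :|: W) * e (b |: W'))); first by rewrite ler_piMr.
by apply: le_trans ee _; rewrite ler_peMr // lerDr.
Qed.

Lemma term_setU1 T : T \subset B ->
  term t.+1 V (b |: T) =
    - term t (b |: V) T
    + (#|T| < t)%N%:R * ((-1) ^+ #|T| * conv (coef V) (coef [set b]) T).
Proof.
move=> sT; have bT : b \notin T by apply: contra bB => /(subsetP sT).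
rewrite /term cardsU1 bT add1n ltnS exprS mulN1r cluster_coefU1 // mulNr mulrN.
by rewrite !mulrBr opprB addrC.
Qed.

(** Splitting [T] means choosing a disjoint pair, and a total size below [t] makes both truncations
    in [term] inactive. [W] ranges over subsets of [b |: B] to match the expansion of
    [cavoid V (b |: B)]. *)
Lemma conv_terms :
  \sum_(T : {set I} | T \subset B)
     (#|T| < t)%N%:R * ((-1) ^+ #|T| * conv (coef V) (coef [set b]) T) =
  \sum_(W : {set I} | W \subset b |: B) \sum_(W' : {set I} | W' \subset B)
     (~~ overlapping W W')%:R * (term t V W * term t [set b] W').
Proof.
rewrite subsetU1_sum // [X in _ = _ + X]big1 ?addr0; last first.
  by move=> W _; rewrite big1 // => W' _; rewrite /overlapping setU11 mul0r.
rewrite /conv; under eq_bigr => T _ do rewrite !big_distrr /=.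
rewrite (exchange_big_dep (fun W : {set I} => W \subset B)) /=; last first.
  by move=> T W sT sW; apply: subset_trans sT.
apply: eq_bigr => W sW.
rewrite (reindex_onto (fun W' => W :|: W') (fun T => T :\: W)) /=; last first.
  by move=> T /andP[_ sWT]; rewrite setUDK.
rewrite big_mkcond [RHS]big_mkcond; apply: eq_bigr => W' _.
have bW : b \notin W by apply: contra bB => /(subsetP sW).
rewrite subUset sW subsetUl andbT /= setDUl setDv set0U.
have -> : (W' :\: W == W') = [disjoint W & W'] by rewrite disjoint_sym; apply/eqP/setDidPl.
rewrite /overlapping (negbTE bW) /=; case: ifP => [/andP[-> dWW']|].
  rewrite dWW' /= -ltnNge.
  have -> : W' :\: W = W' by apply/setDidPl; rewrite disjoint_sym.
  have cU : #|W :|: W'| = (#|W| + #|W'|)%N.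
    by move: dWW'; rewrite -setI_eq0 cardsU => /eqP ->; rewrite cards0 subn0.
  rewrite cU /term; case: ltnP => [lt|]; last by rewrite !mul0r.
  rewrite (leq_ltn_trans _ lt) ?leq_addr // (leq_ltn_trans _ lt) ?leq_addl //.
  by rewrite !mul1r exprD mulrACA.
by case: (W' \subset B) => //= ->; rewrite mul0r.
Qed.

Let C := coef_bound t.
Let M := error_bound t.
Let pairs (F : {set I} -> {set I} -> R) :=
  \sum_(W : {set I} | W \subset b |: B) \sum_(W' : {set I} | W' \subset B) F W W'.
Let joined W W' := weight t.+1 V (b |: (W :|: W')).

Lemma le_pairs F G :
  (forall W W', W \subset b |: B -> W' \subset B -> F W W' <= G W W') -> pairs F <= pairs G.
Proof. by move=> FG; apply: ler_sum => W sW; apply: ler_sum => W' sW'; apply: FG. Qed.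

Lemma pairs_mul F G :
  (\sum_(W : {set I} | W \subset b |: B) F W) * (\sum_(W' : {set I} | W' \subset B) G W') =
  pairs (fun W W' => F W * G W').
Proof. by rewrite big_distrl /=; apply: eq_bigr => W _; rewrite big_distrr. Qed.

Lemma pairsZ c F : pairs (fun W W' => c * F W W') = c * pairs F.
Proof. by rewrite big_distrr /=; apply: eq_bigr => W _; rewrite big_distrr. Qed.

Let disjoint_bB W' : W' \subset B -> [disjoint [set b] & W'].
Proof. by move=> sW'; rewrite disjoints1; apply: contra bB => /(subsetP sW'). Qed.

(** The two summands of the weight are merged separately, hence the factor 2. In the second one,
    either [W] is large enough to make the pair overlapping, or the indicator is 0. *)
Lemma weight_e_le W W' : W \subset b |: B -> W' \subset B ->
  weight t V W * (rootind l [set b] W' * e (b |: W')) <= 2 * joined W W'.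
Proof.
move=> sW sW'; rewrite /weight -/l.
set r := rootind l V W; set r' := rootind l _ _.
have -> : r * (e (V :|: W) * (emax (V :|: W) + (t <= #|W|)%N%:R)) * (r' * e (b |: W')) =
    r * r' * (e (V :|: W) * e (b |: W')) * emax (V :|: W)
    + r * r' * (e (V :|: W) * e (b |: W')) * (t <= #|W|)%N%:R.
  rewrite -mulrDr mulrACA -!mulrA; do 2!congr (_ * _); congr (_ * _); exact: mulrC.
rewrite mulr2n mulrDl mul1r lerD //; apply: weight_merge => //.
- exact: emax_ge0.
- by left; apply/emaxS/setUS; rewrite setUCA subsetUl.
- case: (leqP t #|W|) => tW; last by left; apply: emax_ge0.
  by right; rewrite lexx /overlapping (leq_trans tW) ?leq_addr ?orbT.
Qed.

Lemma e_weight_le W W' : W \subset b |: B -> W' \subset B ->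
  rootind l V W * e (V :|: W) * weight t [set b] W' <= 2 * joined W W'.
Proof.
move=> sW sW'; rewrite /weight -/l.
set r := rootind l V W; set r' := rootind l _ _.
have -> : r * e (V :|: W) * (r' * (e (b |: W') * (emax (b |: W') + (t <= #|W'|)%N%:R))) =
    r * r' * (e (V :|: W) * e (b |: W')) * emax (b |: W')
    + r * r' * (e (V :|: W) * e (b |: W')) * (t <= #|W'|)%N%:R.
  by rewrite -mulrDr mulrACA -!mulrA.
rewrite mulr2n mulrDl mul1r lerD //; apply: weight_merge => //.
- exact: emax_ge0.
- left; apply/emaxS/subsetP => x; rewrite !inE => /orP[->|->]; first by rewrite orbT.
  by rewrite !orbT.
- case: (leqP t #|W'|) => tW; last by left; apply: emax_ge0.
  by right; rewrite lexx /overlapping (leq_trans tW) ?leq_addl ?orbT.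
Qed.

Lemma overlapping_term_le W W' : W \subset b |: B -> W' \subset B -> overlapping W W' ->
  `|term t V W * term t [set b] W'| <= (C ^ 2)%:R * joined W W'.
Proof.
move=> sW sW' ov; rewrite normrM.
have H1 := term_bound t (disjointWr sW dV); have H2 := term_bound t (disjoint_bB sW').
apply: le_trans (ler_pM _ _ H1 H2) _ => //.
rewrite mulrACA -natrM mulnn ler_wpM2l // mulrACA -[leLHS]mulr1.
by apply: weight_merge => //; right; rewrite lexx.
Qed.

Hypothesis IHt : forall V A, [disjoint V & A] ->
  `|cavoid V A - \sum_(T : {set I} | T \subset A) term t V T|
    <= M%:R * \sum_(T : {set I} | T \subset A) weight t V T.

(** The two factors are replaced by their expansions one after the other; what remains is the full
    product of the expansions minus the truncated convolution. *)
Lemma product_expansion :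
  `|cavoid V (b |: B) * cavoid [set b] B - \sum_(T : {set I} | T \subset B)
      (#|T| < t)%N%:R * ((-1) ^+ #|T| * conv (coef V) (coef [set b]) T)|
  <= (2 * M + 2 * (C * M) + C ^ 2)%:R * pairs joined.
Proof.
rewrite conv_terms; set N := \sum_(W | _) _.
set q := cavoid V _; set q' := cavoid _ B.
pose s := \sum_(W : {set I} | W \subset b |: B) term t V W.
pose s' := \sum_(W' : {set I} | W' \subset B) term t [set b] W'.
have dbB : [disjoint [set b] & B] by apply: disjoint_bB.
have -> : q * q' - N = (q - s) * q' + s * (q' - s') + (s * s' - N).
  by ring.
have j_ge0 : 0 <= pairs joined.
  by apply: sumr_ge0 => W _; apply: sumr_ge0 => W' _; apply: weight_ge0.
rewrite 2!natrD [leRHS]mulrDl [X in _ <= X + _]mulrDl.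
apply: le_trans (ler_normD _ _) _; apply: lerD.
  apply: le_trans (ler_normD _ _) _; apply: lerD.
    rewrite normrM (ger0_norm (cavoid_ge0 _ _)).
    (* The bound [e [set b]] is the summand at [set0]; enlarging it to a sum turns the product into
       a sum over pairs. *)
    have q'_le : q' <= \sum_(W' : {set I} | W' \subset B) rootind l [set b] W' * e (b |: W').
      apply: le_trans (cavoid_le _ _) _; rewrite (bigD1 set0) ?sub0set //=.
      rewrite /rootind rooted0 cards0 /= mul1r setU0 lerDl sumr_ge0 // => W' _.
      by rewrite mulr_ge0 ?rootind_ge0.
    apply: le_trans (ler_pM _ _ (IHt dV) q'_le) _ => //; first exact: cavoid_ge0.
    rewrite -mulrA pairs_mul mulnC natrM -mulrA -pairsZ ler_wpM2l //.
    by apply: le_pairs => W W' sW sW'; apply: weight_e_le.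
  rewrite normrM.
  have s_le : `|s| <= C%:R * \sum_(W : {set I} | W \subset b |: B) rootind l V W * e (V :|: W).
    apply: le_trans (ler_norm_sum _ _ _) _; rewrite big_distrr /=; apply: ler_sum => W sW.
    exact/term_bound/(disjointWr sW dV).
  apply: le_trans (ler_pM _ _ s_le (IHt dbB)) _ => //.
  rewrite mulrACA pairs_mul -natrM [(2 * _)%N]mulnC [X in _ <= X * _]natrM -[leRHS]mulrA.
  rewrite -[X in _ <= _ * X]pairsZ ler_wpM2l //.
  by apply: le_pairs => W W' sW sW'; apply: e_weight_le.
(* The pairs that do not overlap cancel against [N]. *)
have -> : s * s' - N = pairs (fun W W' => (overlapping W W')%:R * (term t V W * term t [set b] W')).
  rewrite /s /s' pairs_mul -sumrB; apply: eq_bigr => W _; rewrite -sumrB; apply: eq_bigr => W' _.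
  by case: overlapping; rewrite ?mul0r ?mul1r ?subr0 ?subrr.
apply: le_trans (ler_norm_sum _ _ _) _; rewrite -pairsZ; apply: ler_sum => W sW.
apply: le_trans (ler_norm_sum _ _ _) _; apply: ler_sum => W' sW'.
have [ov|_] := boolP (overlapping W W'); first by rewrite mul1r overlapping_term_le.
by rewrite mul0r normr0 mulr_ge0 // weight_ge0.
Qed.

(** By [cavoidU1] and [term_setU1] the difference splits into three: order [t.+1] on the smaller set
    [B], order [t] for [b |: V], and the product. *)
Lemma cavoid_expansion_step :
  `|cavoid V B - \sum_(T : {set I} | T \subset B) term t.+1 V T|
    <= (error_bound t.+1)%:R * \sum_(T : {set I} | T \subset B) weight t.+1 V T ->
  `|cavoid V (b |: B) - \sum_(T : {set I} | T \subset b |: B) term t.+1 V T|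
    <= (error_bound t.+1)%:R * \sum_(T : {set I} | T \subset b |: B) weight t.+1 V T.
Proof.
move=> IHB; rewrite !subsetU1_sum // mulrDr.
rewrite (cavoidU1 V bB) (eq_bigr _ term_setU1) big_split /= sumrN.
set sB := \sum_(T | _) term t.+1 V T; set sb := \sum_(T | _) term t _ T; set N := \sum_(T | _) _.
set q := cavoid V B in IHB *; set qb := cavoid (b |: V) B; set qq := _ * _.
have -> : q - qb + qq - (sB + (- sb + N)) = (q - sB) + (- (qb - sb) + (qq - N)).
  by ring.
apply: le_trans (ler_normD _ _) _; apply: lerD => //.
apply: le_trans (ler_normD _ _) _; rewrite normrN.
have dbV : [disjoint b |: V & B].
  have dVB : [disjoint V & B] by apply: disjointWr dV; apply: subsetUr.
  rewrite -setI_eq0 -subset0; apply/subsetP => x; rewrite in_setI in_setU1.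
  move=> /andP[/orP[/eqP->|xV] xB]; first by move: bB; rewrite xB.
  by rewrite (disjointFr dVB xV) in xB.
rewrite [error_bound _]/= natrD mulrDl; apply: lerD.
  apply: le_trans (IHt dbV) _; rewrite ler_wpM2l //; apply: ler_sum; exact: weight_setU1.
(* Weights of order [t.+1] vanish on sets larger than [range_bound t.+1], so few pairs share a
   union. *)
apply: le_trans product_expansion _; rewrite natrM -mulrA ler_wpM2l //.
apply: sum_union_pairs => // T; first exact: weight_ge0.
by move=> lT; rewrite /weight /rootind leqNgt lT andbF mul0r.
Qed.

End Step.

Lemma cavoid_expansion t V A : [disjoint V & A] ->
  `|cavoid V A - \sum_(T : {set I} | T \subset A) term t V T|
    <= (error_bound t)%:R * \sum_(T : {set I} | T \subset A) weight t V T.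
Proof.
elim: t V A => [|t IHt] V A.
  (* At order 0 there are no terms, and [q <= e V] is covered by the weight at [set0], where the
     size condition reads [0 <= 0]. *)
  move=> dA; rewrite big1 ?subr0 => [|T _]; last by rewrite /term ltn0 mul0r.
  rewrite ger0_norm ?cavoid_ge0 // mul1r (bigD1 set0) ?sub0set //=.
  apply: le_trans (cavoid_le _ _) _; rewrite -[leLHS]addr0 lerD ?sumr_ge0 //.
    by rewrite /weight /rootind rooted0 cards0 /= mul1r setU0 ler_peMr // lerDr emax_ge0.
  by move=> T _; apply: weight_ge0.
(* The order is now fixed at [t.+1] and the inner induction is on the size of [A]. *)
have [n leAn] := ubnP #|A|; elim: n => // n IHn in A leAn *; move=> dA.
have [tA|nA] := boolP (touch V A).
  have [b bA bV] := touch_pick tA.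
  have eA := setD1K bA; rewrite -eA; apply: cavoid_expansion_step => //.
  - by rewrite !inE eqxx.
  - by rewrite eA.
  apply: IHn; first by move: leAn; rewrite (cardsD1 b) bA.
  by apply: disjointWr dA; apply: subD1set.
(* Here [q(V; A) = e V] is exactly the term at [set0], and all other terms vanish. *)
rewrite cavoid_untouched // (bigD1 set0) ?sub0set //= big1 ?addr0.
  rewrite /term cards0 mul1r mul1r cluster_coef0 subrr normr0.
  by rewrite mulr_ge0 // sumr_ge0 // => T _; apply: weight_ge0.
move=> T /andP[sT T0]; rewrite /term cluster_coef_untouched ?mulr0 //.
  exact: disjointWr dA.
by apply: contra nA; apply: touchS.
Qed.

End ConditionalExpansion.

(** * Expansion of the logarithm *)

(** The lower bound is [ln x <= x - 1] at [x = 1 / (1 - q)], which gives the error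
    [q ^ 2 / (1 - q)]. *)
Lemma ln1B_bound (R : realType) (eps q : R) : 0 < eps -> 0 <= q <= 1 - eps ->
  `|ln (1 - q) + q| <= q ^+ 2 / eps.
Proof.
move=> eps0 /andP[q0 q1]; have p0 : 0 < 1 - q by lra.
have upper : ln (1 - q) <= - q by apply: le_ln1Dx; lra.
have lower : - ln (1 - q) <= q / (1 - q).
  have E : (1 - q)^-1 = 1 + q / (1 - q) by field; rewrite gt_eqF.
  rewrite -lnV ?posrE // [X in ln X]E; apply: le_ln1Dx.
  by apply: (@lt_le_trans _ _ 0); [lra | rewrite divr_ge0 // ltW].
have -> : q ^+ 2 / eps = q / (1 - q) - q + q ^+ 2 * (eps^-1 - (1 - q)^-1).
  by field; rewrite !gt_eqF.
have : 0 <= q ^+ 2 * (eps^-1 - (1 - q)^-1).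
  by rewrite mulr_ge0 ?sqr_ge0 // subr_ge0 lef_pV2 ?posrE //; lra.
by rewrite ler_norml => H; apply/andP; split; lra.
Qed.

Section LogExpansion.
Variables (R : realType) (I : finType) (adj : rel I) (e : {set I} -> R).
Variables (conn : pred {set I}) (eps : R) (k : nat).
Implicit Types (A B T U V W : {set I}).

Hypothesis e0 : e set0 = 1.
Hypothesis e_ge0 : forall V, 0 <= e V.
Hypothesis e_anti : forall V W, V \subset W -> e W <= e V.
Hypothesis e_cap : forall V W, e V * e W <= e (V :|: W) * e (V :&: W).
Hypothesis e_sep : forall V W, [disjoint V & W] -> ~~ touch adj V W -> e (V :|: W) = e V * e W.
Hypothesis avoid_ge0 : forall V A, 0 <= avoid e V A.
Hypothesis avoid0_gt0 : forall A, 0 < avoid e set0 A.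
Hypothesis avoid_le : forall V A, avoid e V A <= e V * avoid e set0 A.
Hypothesis conn0 : conn set0 = false.
Hypothesis connU1 : forall i T, i \notin T -> conn (i |: T) = rooted adj [set i] T.
Hypothesis eps_gt0 : 0 < eps.
Hypothesis e1_le : forall i, e [set i] <= 1 - eps.

(** Removing an index [i] from [A] splits off [ln (1 - q)], and the sets [V] containing [i] account
    for the expansion of [q]. The constant adds the error of that expansion to the error of the
    logarithm. *)
Lemma ln_avoid_expansion A :
  `|ln (avoid e set0 A)
    + \sum_(V : {set I} | V \subset A)
        (conn V && (#|V| <= k)%N)%:R * ((-1) ^+ #|V|.+1 * cumulant e V)|
  <= ((error_bound k)%:R + eps^-1) *
     \sum_(V : {set I} | V \subset A) (conn V && (#|V| <= (range_bound k).+1)%N)%:R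
        * (e V * (emax e V + (k < #|V|)%N%:R)).
Proof.
have [n leAn] := ubnP #|A|; elim: n => // n IHn in A leAn *.
have [A0|[i iA]] := set_0Vmem A.
  have sum0 F : \sum_(V : {set I} | V \subset set0) F V = F set0 :> R.
    by apply: big_pred1 => V; rewrite subset0.
  by rewrite A0 /avoid !sum0 conn0 !mul0r mulr0 addr0 cards0 setU0 e0 mulr1 ln1 normr0.
have eA := setD1K iA; set B := A :\ i in eA.
have iB : i \notin B by rewrite !inE eqxx.
have leBn : (#|B| < n)%N by move: leAn; rewrite (cardsD1 i) iA.
have {IHn} IHB := IHn B leBn.
rewrite -eA !subsetU1_sum // mulrDr.
set q := cavoid e [set i] B.
have q_ge0 : 0 <= q by apply: cavoid_ge0.
have q_le : q <= e [set i] by apply: cavoid_le.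
have lnE : ln (avoid e set0 (i |: B)) = ln (avoid e set0 B) + ln (1 - q).
  have q_lt1 : 0 < 1 - q by rewrite subr_gt0 (le_lt_trans q_le) // (le_lt_trans (e1_le i)) // gtrBl.
  rewrite -lnM ?posrE //.
  rewrite avoidU1 // setU0 mulrBr mulr1; congr (ln (_ - _)).
  by rewrite /q /cavoid mulrC divfK // gt_eqF.
have termE T : T \subset B ->
    (conn (i |: T) && (#|i |: T| <= k)%N)%:R * ((-1) ^+ #|i |: T|.+1 * cumulant e (i |: T))
    = term e k [set i] T.
  move=> sT; have iT : i \notin T by apply: contra iB => /(subsetP sT).
  rewrite cumulantU1 // connU1 // cardsU1 iT add1n !exprS mulN1r mulN1r opprK /term.
  (* For a disconnected set the coefficient is 0, because of the factor [rooted] in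
     [cluster_coef_bound]. *)
  case rT: (rooted adj [set i] T) => //=.
  have dT : [disjoint [set i] & T] by rewrite disjoints1.
  have := cluster_coef_bound e0 e_ge0 e_anti e_cap e_sep dT (leqnn _).
  by rewrite rT mulr0 mul0r normr_le0 => /eqP ->; rewrite !mulr0.
have weightE T : T \subset B ->
    (conn (i |: T) && (#|i |: T| <= (range_bound k).+1)%N)%:R
      * (e (i |: T) * (emax e (i |: T) + (k < #|i |: T|)%N%:R))
    = weight adj e k [set i] T.
  move=> sT; have iT : i \notin T by apply: contra iB => /(subsetP sT).
  by rewrite connU1 // cardsU1 iT add1n !ltnS.
rewrite (eq_bigr _ termE) (eq_bigr _ weightE) lnE.
set SB := \sum_(V | _) _ * (_ * cumulant e V) in IHB *; set S := \sum_(T | _) term e k _ T.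
set WB := \sum_(V | _) _ * (_ * (_ + _)) in IHB *; set W := \sum_(T | _) weight _ _ _ _ T.
have -> : ln (avoid e set0 B) + ln (1 - q) + (SB + S) =
    (ln (avoid e set0 B) + SB) + ((ln (1 - q) + q) - (q - S)) by ring.
apply: le_trans (ler_normD _ _) _; apply: lerD => //.
apply: le_trans (ler_normB _ _) _; rewrite mulrDl addrC; apply: lerD.
  by apply: cavoid_expansion => //; rewrite disjoints1.
have q_le1 : q <= 1 - eps by apply: le_trans q_le (e1_le i).
apply: le_trans (ln1B_bound eps_gt0 _) _; first by rewrite q_ge0.
(* [q ^ 2] is at most [e [set i] * emax e [set i]], which is covered by the weight at [set0]. *)
rewrite mulrC ler_wpM2l ?invr_ge0 ?(ltW eps_gt0) // /W (bigD1 set0) ?sub0set //=.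
rewrite -[leLHS]addr0; apply: lerD; last by apply: sumr_ge0 => T _; apply: weight_ge0.
rewrite /weight /rootind rooted0 cards0 mul1r setU0 expr2 ler_pM //.
by apply: le_trans q_le _; apply: le_trans (le_emax _ (set11 i)) _; rewrite lerDl.
Qed.

End LogExpansion.

(** * Random subsets and clusters of edges *)

Section RandomSubsetTheory.
Variables (R : realType) (Omega : finType) (p : Omega -> R).
Hypothesis p01 : forall w, 0 < p w < 1.
Implicit Types (S U : {set Omega}) (f g : {set Omega} -> R).

Lemma rs_mass_gt0 S : 0 < rs_mass p S.
Proof. by apply: prodr_gt0 => w _; have := p01 w; case: ifP => _; lra. Qed.

Lemma rs_E1 : rs_E p (fun=> 1) = 1.
Proof.
rewrite /rs_E; under eq_bigr do rewrite mulr1.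
rewrite -(bigA_distr 1 +%R p (fun w => 1 - p w)) big1 // => w _ /=; ring.
Qed.

Lemma eq_rs_E f g : f =1 g -> rs_E p f = rs_E p g.
Proof. by move=> fg; apply: eq_bigr => S _; rewrite fg. Qed.

Lemma rs_EB f g : rs_E p (fun S => f S - g S) = rs_E p f - rs_E p g.
Proof. by rewrite /rs_E -sumrB; apply: eq_bigr => S _; rewrite mulrBr. Qed.

Lemma le_rs_E f g : (forall S, f S <= g S) -> rs_E p f <= rs_E p g.
Proof. by move=> fg; apply: ler_sum => S _; rewrite ler_wpM2l // ltW // rs_mass_gt0. Qed.

(** For [w] outside [S], the mass of [w |: S] is [p w] times the sum of the masses of [S] and
    [w |: S]. *)
Lemma rs_E_mem w f : rs_E p (fun S => (w \in S)%:R * f S) = p w * rs_E p (fun S => f (w |: S)).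
Proof.
have split h : \sum_S h S = \sum_(S : {set Omega} | S \subset ~: [set w]) h S
    + \sum_(S : {set Omega} | S \subset ~: [set w]) h (w |: S) :> R.
  rewrite -subsetU1_sum ?inE ?eqxx //; apply: eq_bigl => S.
  by rewrite setUCr subsetT.
rewrite /rs_E !split big1 ?add0r; last first.
  move=> S /subsetP sS; case: (boolP (w \in S)) => wS; last by rewrite mul0r mulr0.
  by move: (sS w wS); rewrite !inE eqxx.
rewrite -big_split big_distrr /=; apply: eq_bigr => S /subsetP sS.
have wS : w \notin S by apply/negP => /sS; rewrite !inE eqxx.
rewrite setU11 mul1r setUA setUid -mulrDl mulrA; congr (_ * _).
have -> : rs_mass p S = (1 - p w) * \prod_(x | x != w) (if x \in w |: S then p x else 1 - p x).
  rewrite /rs_mass (bigD1 w) //= (negbTE wS); congr (_ * _).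
  by apply: eq_bigr => x /negbTE xw; rewrite !inE xw.
by rewrite /rs_mass (bigD1 w) //= setU11; ring.
Qed.

Lemma rs_E_subset U f :
  rs_E p (fun S => (U \subset S)%:R * f S) = (\prod_(w in U) p w) * rs_E p (fun S => f (U :|: S)).
Proof.
have [n leUn] := ubnP #|U|; elim: n => // n IHn in U leUn f *.
have [->|[w wU]] := set_0Vmem U.
  by rewrite big_set0 mul1r; apply: eq_rs_E => S; rewrite sub0set mul1r set0U.
have leU : (#|U :\ w| < n)%N by move: leUn; rewrite (cardsD1 w) wU.
rewrite (big_setD1 w) //= -mulrA.
transitivity (rs_E p (fun S => (w \in S)%:R * ((U :\ w \subset S)%:R * f S))).
  apply: eq_rs_E => S; rewrite mulrA -natrM mulnb; congr (_%:R * _).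
  by rewrite -{1}(setD1K wU) subUset sub1set.
rewrite rs_E_mem; congr (_ * _).
transitivity (rs_E p (fun S => (U :\ w \subset S)%:R * f (w |: S))).
  apply: eq_rs_E => S; congr ((nat_of_bool _)%:R * _); apply/subsetP/subsetP => sU x xU.
    by have := sU x xU; move: xU; rewrite !inE => /andP[/negbTE ->].
  by rewrite inE sU ?orbT.
rewrite (IHn _ leU (fun S => f (w |: S))); congr (_ * _); apply: eq_rs_E => S.
by rewrite setUA setD1K.
Qed.

Lemma rs_Pr_E (A : pred {set Omega}) : rs_Pr p A = rs_E p (fun S => (A S)%:R).
Proof. by rewrite /rs_Pr big_mkcond; apply: eq_bigr => S _; case: (A S); rewrite ?mulr1 ?mulr0. Qed.

Variable E : {set {set Omega}}.
Local Notation I := 'I_#|E|.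
Implicit Types (V W T A : {set I}).

Definition span V : {set Omega} := \bigcup_(i in V) edge i.
Local Notation pr U := (\prod_(w in U) p w).
Definition moment V : R := rs_E p (Xprod R V).
Local Notation e := moment.

Lemma XprodE V S : Xprod R V S = (span V \subset S)%:R.
Proof.
have -> : (span V \subset S) = [forall i in V, edge i \subset S].
  by apply/bigcupsP/forall_inP.
rewrite /Xprod; case: (boolP [forall _ in _, _]) => [/forall_inP H|].
  by rewrite big1 // => i iV; rewrite /Xind H.
rewrite negb_forall_in => /exists_inP[i iV ni].
by rewrite (bigD1 i) //= /Xind (negbTE ni) mul0r.
Qed.

Lemma momentE V : moment V = pr (span V).
Proof.
rewrite /moment.
have := rs_E_subset (span V) (fun=> 1); rewrite rs_E1 mulr1 => <-.
by apply: eq_rs_E => S; rewrite XprodE mulr1.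
Qed.

Lemma pr_gt0 U : 0 < pr U.
Proof. by apply: prodr_gt0 => w _; have := p01 w; lra. Qed.

Lemma pr_anti U U' : U \subset U' -> pr U' <= pr U.
Proof.
move=> sU; rewrite (big_setID U) /= (setIidPr sU) ler_piMr ?(ltW (pr_gt0 _)) //.
by apply: prodr_ile1 => w _; have := p01 w; lra.
Qed.

Lemma prUI U U' : pr U * pr U' = pr (U :|: U') * pr (U :&: U').
Proof.
rewrite [pr (U :|: U')](big_setID U) /= setUK setDUl setDv set0U -mulrA; congr (_ * _).
by rewrite [LHS](big_setID U) /= mulrC setIC.
Qed.

Lemma spanS V W : V \subset W -> span V \subset span W.
Proof.
by move=> sV; apply/bigcupsP => i iV; apply: bigcup_sup; apply: (subsetP sV).
Qed.

Lemma spanU V W : span (V :|: W) = span V :|: span W.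
Proof. exact: bigcup_setU. Qed.

(** Products of [p] satisfy [prUI] with equality; the inequality arises because [span (V :&: W)] may
    be smaller than the intersection of the spans. *)
Lemma moment_cap V W : e V * e W <= e (V :|: W) * e (V :&: W).
Proof.
rewrite !momentE prUI spanU ler_wpM2l ?(ltW (pr_gt0 _)) // pr_anti //.
by rewrite subsetI !spanS ?subsetIl ?subsetIr.
Qed.

Lemma moment_sep V W : [disjoint V & W] -> ~~ touch (@dep_graph _ E) V W ->
  e (V :|: W) = e V * e W.
Proof.
move=> dVW nt; rewrite !momentE prUI spanU.
suff -> : span V :&: span W = set0 by rewrite big_set0 mulr1.
apply/eqP; rewrite -subset0; apply/subsetP => w.
rewrite inE => /andP[/bigcupP[i iV wi] /bigcupP[j jW wj]].
(* A shared vertex makes [i] and [j] adjacent; disjointness of [V] and [W] provides [i != j]. *)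
case/negP: nt; apply/touchP; exists i, j; split=> //; apply/andP; split.
  by apply: contraTneq iV => ->; rewrite (disjointFl dVW jW).
by apply/set0Pn; exists w; rewrite inE wi.
Qed.

Definition miss A S : R := \prod_(j in A) (1 - Xind R j S).

Lemma miss_ge0 A S : 0 <= miss A S.
Proof. by apply: prodr_ge0 => i _; rewrite /Xind; case: (_ \subset _) => /=; lra. Qed.

(** Both sides obey the recursion [avoidU1]: a factor [1 - X_i] subtracts the expectation with [i]
    joined to [V]. *)
Lemma avoidE V A : avoid e V A = rs_E p (fun S => Xprod R V S * miss A S).
Proof.
have [n leAn] := ubnP #|A|; elim: n => // n IHn in V A leAn *.
have [->|[i iA]] := set_0Vmem A.
  rewrite /avoid (big_pred1 set0) => [|T]; last by rewrite subset0.
  rewrite cards0 mul1r setU0; apply: eq_rs_E => S.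
  by rewrite /miss big_set0 mulr1.
have eA := setD1K iA; set B := A :\ i in eA.
have iB : i \notin B by rewrite !inE eqxx.
have leBn : (#|B| < n)%N by move: leAn; rewrite (cardsD1 i) iA.
rewrite -eA avoidU1 // !IHn // -rs_EB; apply: eq_rs_E => S.
rewrite -mulrBl /miss big_setU1 //= mulrA; congr (_ * _).
rewrite mulrBr mulr1; congr (_ - _); rewrite !XprodE /Xind /span -natrM mulnb.
by congr (_%:R); rewrite -/(span _) -/(span _) spanU subUset /span big_set1 andbC.
Qed.

Lemma avoid_ge0 V A : 0 <= avoid e V A.
Proof.
rewrite avoidE; apply: sumr_ge0 => S _; rewrite XprodE.
by rewrite !mulr_ge0 ?miss_ge0 ?(ltW (rs_mass_gt0 _)).
Qed.

(* Conditioning on [span V \subset S] replaces [S] by [span V :|: S]. *)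
Lemma avoid_le V A : avoid e V A <= e V * avoid e set0 A.
Proof.
rewrite !avoidE momentE.
rewrite (eq_rs_E (g := fun S => (span V \subset S)%:R * miss A S)) => [|S]; last by rewrite XprodE.
rewrite rs_E_subset ler_wpM2l ?(ltW (pr_gt0 _)) //; apply: le_rs_E => S.
rewrite /Xprod big_set0 mul1r /miss; apply: ler_prod => i _; rewrite /Xind.
case: (boolP (edge i \subset S)) => iS; first by rewrite (subset_trans iS) ?subsetUr //=; lra.
by case: (_ \subset _) => /=; lra.
Qed.

(** The outcome [set0] has positive mass and contains no edge. *)
Lemma avoid0_gt0 A : (forall i : I, edge i != set0) -> 0 < avoid e set0 A.
Proof.
move=> ne; rewrite avoidE /rs_E (bigD1 set0) //= ltr_pwDl //.
  rewrite /Xprod big_set0 mul1r /miss big1 ?mulr1 ?rs_mass_gt0 // => i _.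
  by rewrite /Xind subset0 (negbTE (ne i)) subr0.
apply: sumr_ge0 => S _; rewrite /Xprod big_set0 mul1r mulr_ge0 ?miss_ge0 ?(ltW (rs_mass_gt0 _)) //.
Qed.

Lemma Pr_Xcount0 : rs_Pr p (fun S => Xcount R E S == 0) = avoid e set0 setT.
Proof.
rewrite rs_Pr_E avoidE; apply: eq_rs_E => S; rewrite /Xprod big_set0 mul1r.
have X01 i : 0 <= Xind R i S by rewrite /Xind.
rewrite /Xcount psumr_eq0 => [|i _]; last exact: X01.
case: (boolP (all _ _)) => [/allP H|].
  rewrite /miss big1 // => i _; have := H i; rewrite mem_index_enum => /(_ isT) /eqP ->.
  by rewrite subr0.
case/allPn => i _ /=; rewrite /Xind => Xi; rewrite /miss (bigD1 i) ?inE //= /Xind.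
by move: Xi; case: (_ \subset _) => [_|] /=; rewrite ?subrr ?mul0r ?eqxx.
Qed.

End RandomSubsetTheory.

Arguments moment {R Omega} p {E} V.

(** * Connected sets of edges *)

Section Clusters.
Variables (Omega : finType) (E : {set {set Omega}}).
Implicit Types (T U V : {set 'I_#|E|}).

Lemma dep_graph_sym : symmetric (@dep_graph Omega E).
Proof. by move=> i j; rewrite /dep_graph eq_sym setIC. Qed.

Lemma induced_connect_sym V : connect_sym (induced V).
Proof.
by apply: sym_connect_sym => i j; rewrite /induced dep_graph_sym andbCA.
Qed.

(** The complement of an uncrossed cut would be closed under paths while containing [i]; conversely,
    the vertices unreachable from [i] would form an uncrossed cut. *)
Lemma connected_inU1 i T : i \notin T ->
  connected_in (i |: T) = rooted (@dep_graph Omega E) [set i] T.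
Proof.
move=> iT; have iV : i \in i |: T by rewrite setU11.
have n0 : i |: T != set0 by apply/set0Pn; exists i.
rewrite /connected_in n0 /=; apply/idP/rootedP => [/forall_inP con U sU U0|rT].
  have [j jU] := set0Pn _ U0; apply: contraT => nt.
  have jV : j \in i |: T by rewrite inE (subsetP sU j jU) orbT.
  have cij : connect (induced (i |: T)) i j by move/forall_inP: (con i iV) => ->.
  have cl : closed (induced (i |: T)) (mem ((i |: T) :\: U)).
    apply: intro_closed; first exact: induced_connect_sym.
    move=> x y /and3P[xV yV xy]; rewrite !inE => /andP[xU _]; rewrite -in_setU1 yV andbT.
    apply: contra nt => yU; apply/touchP; exists x, y; split=> //.
    by rewrite in_setD xU.
  have := closed_connect cl cij; rewrite !inE jU eqxx /=.
  by rewrite (contra (subsetP sU i)).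
have con j : j \in i |: T -> connect (induced (i |: T)) i j.
  move=> jV; apply/negPn; apply/negP => nc.
  pose U := [set x in T | ~~ connect (induced (i |: T)) i x].
  have jU : j \in U.
    rewrite inE nc andbT; case/setU1P: jV nc => [->|//]; by rewrite connect0.
  have sU : U \subset T by apply/subsetP => x; rewrite inE => /andP[].
  have U0 : U != set0 by apply/set0Pn; exists j.
  have /touchP[x [y [+ yU xy]]] := rT U sU U0.
  rewrite in_setD => /andP[xU xV].
  have yT := subsetP sU y yU; move: yU; rewrite inE yT /= => /negP; apply.
  have ix : connect (induced (i |: T)) i x.
    case/setU1P: (xV) => [->|xT]; first exact: connect0.
    by move: xU; rewrite inE xT /= negbK.
  by apply: connect_trans ix (connect1 _); rewrite /induced xV xy inE yT orbT.
apply/forall_inP => x xV; apply/forall_inP => y yV.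
by apply: connect_trans (con y yV); rewrite induced_connect_sym con.
Qed.

Lemma sum_clusters (R : nmodType) (F : {set 'I_#|E|} -> R) a b :
  \sum_(a <= m < b) \sum_(V in clusters E m) F V =
  \sum_(V : {set 'I_#|E|} | connected_in V && (a <= #|V| < b)%N) F V.
Proof.
under eq_bigr => m _ do (rewrite big_mkcond; under eq_bigr => V _ do rewrite inE).
rewrite exchange_big [RHS]big_mkcond /=; apply: eq_bigr => V _.
case: (connected_in V) => /=; last by rewrite big1 // => m _; rewrite andbF.
under eq_bigr => m _ do rewrite andbT.
by rewrite -big_mkcond /= (eq_bigl (fun m => m == #|V|)) ?big_nat1_eq // => m; rewrite eq_sym.
Qed.

End Clusters.

(** Take [V = [set i]] in the maximum: its event contains the event [X_i = 1]. *)
Lemma moment_set1_le_rho (R : realType) (Omega : finType) (E : {set {set Omega}})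
    (p : Omega -> R) (i : 'I_#|E|) (k : nat) :
  (forall w, 0 < p w < 1) -> moment p [set i] <= rho E p k.+1.
Proof.
move=> p01; rewrite /rho (bigD1 [set i]) ?cards1 //= le_max; apply/orP; left.
rewrite rs_Pr_E; apply: le_rs_E => // S; rewrite XprodE /span big_set1 ler_nat.
case: (boolP (edge i \subset S)) => //= iS; rewrite lt0b; apply/existsP; exists i.
by rewrite !inE eqxx /Xind iS /= eqxx.
Qed.

Theorem theorem1p11 (R : realType) (k : nat) (eps : R) (eps_gt0 : 0 < eps) :
  exists K : nat,
    forall (Omega : finType) (E : {set {set Omega}}) (p : Omega -> R),
      (forall w, 0 < p w < 1) ->
      rho E p k.+1 <= 1 - eps ->
      `| ln (rs_Pr p (fun S => Xcount R E S == 0))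
         + \sum_(1 <= i < k.+1) (-1) ^+ i.+1 * kappa E p i |
      <= K%:R * (\sum_(1 <= i < K.+1) delta E p i
                 + \sum_(k.+1 <= i < K.+1) Delta E p i).
Proof.
pose K0 : R := (error_bound k)%:R + eps^-1.
have K0_ge0 : 0 <= K0 by rewrite addr_ge0 // invr_ge0 ltW.
(* [K] must dominate both the constant [K0] and the largest cluster size [(range_bound k).+1] in the
   error. *)
pose K := (Num.truncn K0 + range_bound k).+1; exists K => Omega E p p01 rho_le.
have K0_le : K0 <= K%:R.
  by apply: le_trans (ltW (truncnS_gt K0)) _; rewrite ler_nat /K ltnS leq_addr.
have e1_le (i : 'I_#|E|) : moment p [set i] <= 1 - eps.
  by apply: le_trans rho_le; apply: moment_set1_le_rho.
(* An empty edge would be present with probability 1, above [1 - eps]. *)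
have ne (i : 'I_#|E|) : edge i != set0.
  apply/eqP => i0; have := e1_le i; rewrite momentE // /span big_set1 i0 big_set0; lra.
have m0 : moment p (set0 : {set 'I_#|E|}) = 1 by rewrite momentE // /span !big_set0.
have m_ge0 (V : {set 'I_#|E|}) : 0 <= moment p V by rewrite momentE // ltW // pr_gt0.
have m_anti (V W : {set 'I_#|E|}) : V \subset W -> moment p W <= moment p V.
  by move=> sV; rewrite !momentE // pr_anti // spanS.
have c0 : connected_in (set0 : {set 'I_#|E|}) = false by rewrite /connected_in eqxx.
have := ln_avoid_expansion k m0 m_ge0 m_anti (moment_cap p01 (E := E))
  (moment_sep p (E := E)) (avoid_ge0 p01 (E := E)) (fun A => avoid0_gt0 p01 A ne)
  (avoid_le p01 (E := E)) c0
  (@connected_inU1 _ E) eps_gt0 e1_le setT.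
rewrite -Pr_Xcount0 //.
have -> : \sum_(V : {set 'I_#|E|} | V \subset setT)
     (connected_in V && (#|V| <= k)%N)%:R * ((-1) ^+ #|V|.+1 * cumulant (moment p) V) =
   \sum_(1 <= i < k.+1) (-1) ^+ i.+1 * kappa E p i.
  transitivity (\sum_(1 <= m < k.+1) \sum_(V in clusters E m) (-1) ^+ #|V|.+1 * joint_cumulant p V).
    rewrite sum_clusters [RHS]big_mkcond; apply: eq_big => [V|V _]; first by rewrite subsetT.
    (* Connected sets are nonempty, so starting the sum at size 1 loses nothing. *)
    rewrite ltnS; case: (boolP (connected_in V)) => [/andP[V0 _]|_] /=; last by rewrite mul0r.
    by rewrite card_gt0 V0 /=; case: leqP => _; rewrite ?mul0r ?mul1r.
  apply: eq_bigr => m _; rewrite /kappa big_distrr /=; apply: eq_bigr => V.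
  by rewrite inE => /andP[/eqP -> _].
move=> H; apply: le_trans H _; apply: ler_pM => //.
  by apply: sumr_ge0 => V _; rewrite !mulr_ge0 ?addr_ge0 ?emax_ge0.
have emaxE (V : {set 'I_#|E|}) :
    emax (moment p) V = \big[Num.max/0]_(i in V) rs_E p (Xind R i).
  apply: eq_bigr => i _; apply: eq_rs_E => S; by rewrite /Xprod big_set1.
(* The comparison is made for each [V] separately: [emax] belongs to [delta], and the indicator of
   [k < #|V|] to [Delta]. *)
rewrite /delta /Delta !sum_clusters big_mkcond [X in _ <= X + _]big_mkcond.
rewrite [X in _ <= _ + X]big_mkcond -big_split /=; apply: ler_sum => V _.
rewrite subsetT -emaxE !ltnS -/(moment p V).
case: (boolP (connected_in V)) => [/andP[V0 _]|_] /=; last by rewrite mul0r addr0.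
rewrite card_gt0 V0 /=.
have lK : ((range_bound k).+1 <= K)%N by rewrite ltnS leq_addl.
have em := emax_ge0 (moment p) V.
case: (leqP #|V| (range_bound k).+1) => lV; last first.
  by rewrite mul0r; case: ifP => _; case: ifP => _; rewrite ?addr_ge0 ?mulr_ge0.
rewrite (leq_trans lV lK) andbT mul1r mulrDr lerD2l.
by case: (k < #|V|)%N; rewrite ?mulr1 ?mulr0.
Qed.
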